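(* For every integer $k\ge 0$, the operator-valued function $x\mapsto \mathbf{P}_k(x)$ is a polynomial in $x$ of degree $k$ (with coefficients that are linear operators on $\mathcal{P}_n$). Moreover, $\mathbf{P}_k$ can be written as the composition $$\mathbf{P}_k=\mathcal{A}_1\mathcal{A}_2\cdots\mathcal{A}_k,\qquad \mathcal{A}_j=x\,(2j+D_1)+D_2+Q\,\partial_x ,$$ that is, for every $\mathbf{q}\in\mathcal{P}_n$ (regarded as constant in $x$), $\mathbf{P}_k(x)\mathbf{q}=\mathcal{A}_1\mathcal{A}_2\cdots\mathcal{A}_k\,\mathbf{q}$ (for $k=0$ the empty composition is the identity).
   Context: Let $d\ge1$ and let $A,B$ be $d\times d$ complex matrices such that (i) $A+B$ is diagonalizable, and (ii) (nonresonance) the eigenvalues $\lambda_1,\dots,\lambda_d$ of $A+B$ (listed with multiplicity), with $\boldsymbol{\lambda}=(\lambda_1,\dots,\lambda_d)$, satisfy $\mathbf{m}\cdot\boldsymbol{\lambda}-\lambda_j\notin\mathbb{Z}_-=\{-1,-2,-3,\dots\}$ for all $\mathbf{m}\in\mathbb{N}^d$ and $j=1,\dots,d$, where $\mathbb{N}=\{0,1,2,\dots\}$. Put $M(x)=\frac{1}{x-1}A+\frac{1}{x+1}B$, $M_1=A+B$, $M_2=A-B$, $Q(x)=x^2-1$, so $QM=xM_1+M_2$. Let $Y$ be a fundamental matrix of solutions of $\mathbf{y}'=M\mathbf{y}$ (so $Y'=MY$, $Y$ invertible), taken locally near a point $x\in\mathbb{C}\setminus\{\pm1\}$. For $n\in\mathbb{N}$,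 let $\mathcal{P}_n$ be the space of $\mathbb{C}^d$-valued polynomials $\mathbf{q}(\mathbf{w})$ in $\mathbf{w}=(w_1,\dots,w_d)$ that are homogeneous of degree $n$. For $k\ge0$ and $x\neq\pm1$ define the linear operator $\mathbf{P}_k(x)$ on $\mathcal{P}_n$ by $$\mathbf{P}_k(x)\mathbf{q}(\mathbf{w})=Y(x)\,\frac{d^k}{dt^k}\Big|_{t=x}\left[Q(t)^k\,Y^{-1}(t)\,\mathbf{q}\left(Y(t)Y^{-1}(x)\mathbf{w}\right)\right].$$ Define linear operators $D_1,D_2$ on $\mathcal{P}_n$ by $D_i\mathbf{q}(\mathbf{w})=\mathrm{d}\mathbf{q}(\mathbf{w})\,M_i\mathbf{w}-M_i\mathbf{q}(\mathbf{w})$, where $\mathrm{d}\mathbf{q}(\mathbf{w})$ is the Jacobian matrix of $\mathbf{q}$ in $\mathbf{w}$. The operators $\mathcal{A}_j$ act on $\mathcal{P}_n$-valued functions $\mathbf{r}(x,\mathbf{w})$ of $x$, with $D_1,D_2$ acting in $\mathbf{w}$ for fixed $x$. *)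

(* Defs.v *)
From HB Require Import structures.
From mathcomp Require Import all_boot all_order all_algebra.
From mathcomp Require Import all_classical all_reals all_analysis.
(* The notations of mpoly clash with those of MathComp-Analysis. *)
From mathcomp Require Import -(notations) mpoly.
From mathcomp Require Import complex.
Set Implicit Arguments.
Unset Strict Implicit.
Unset Printing Implicit Defensive.
Import Order.TTheory GRing.Theory Num.Theory.
Import numFieldNormedType.Exports.
Local Open Scope classical_set_scope.
Local Open Scope ring_scope.

(* The dimension is d.+1: homogeneous polynomial maps K^(d+1) -> K^(d+1) of
   degree n, given by their components. *)
Notation Pn K d n := {ffun 'I_d.+1 -> dhomog d.+1 K n}.

Section HomogeneousVectorPolynomials.
Variables (K : numFieldType) (d n : nat).
Local Notation P := (Pn K d n).

Definition ev (q : P) (w : 'cV[K]_d.+1) : 'cV[K]_d.+1 :=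
  \col_i meval (fun l => w l 0) (q i).

Definition Jac (q : P) : 'M[mpoly d.+1 K]_d.+1 :=
  \matrix_(i, j) mderiv j (q i).

Definition constmx (M : 'M[K]_d.+1) : 'M[mpoly d.+1 K]_d.+1 :=
  map_mx (@mpolyC d.+1 K) M.

Definition vars : 'cV[mpoly d.+1 K]_d.+1 := \col_l mpolyX K (mnm1 l).

Definition polycol (q : P) : 'cV[mpoly d.+1 K]_d.+1 :=
  \col_i mpoly_of_dhomog (q i).

Definition Dcol (M : 'M[K]_d.+1) (q : P) : 'cV[mpoly d.+1 K]_d.+1 :=
  Jac q *m (constmx M *m vars) - constmx M *m polycol q.

Lemma mderiv_mulX_homog (p : mpoly d.+1 K) (j l : 'I_d.+1) :
  p \is ishomog1 n mdeg -> mderiv j p * mpolyX K (mnm1 l) \is ishomog1 n mdeg.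
Proof.
move=> hp; have hd m : m \in msupp (mderiv j p) -> (mdeg m).+1 = n.
  rewrite mcoeff_msupp mcoeff_mderiv => h.
  have : mcoeff (mnm_add m (mnm1 j)) p != 0.
    by apply: contraNneq h => ->; rewrite mul0rn.
  rewrite -mcoeff_msupp => /(dhomog_mf hp) hm.
  by rewrite -hm -[RHS]/(mdeg (mnm_add m (mnm1 j))) mdegD mdeg1 addn1.
have [n0|n_gt0] := posnP n.
  suff -> : mderiv j p = 0 by rewrite mul0r dhomog0.
  apply/mpolyP => m; rewrite mcoeff0; apply/eqP; rewrite mcoeff_eq0.
  by apply/negP => /hd; rewrite n0.
have -> : n = (n.-1 + 1)%N by rewrite addn1 prednK.
apply: dhomogM.
  by apply/dhomogP => m /hd <-.
by rewrite dhomogX; apply/eqP; exact: mdeg1.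
Qed.

Lemma Dcol_homog M q i : Dcol M q i 0 \is ishomog1 n mdeg.
Proof.
rewrite !mxE; apply: rpredB; apply: rpred_sum => j _; last first.
  by rewrite !mxE mul_mpolyC; apply: rpredZ; exact: dhomog_is_dhomog.
rewrite !mxE mulr_sumr; apply: rpred_sum => l _.
rewrite !mxE mul_mpolyC -scalerAr; apply: rpredZ.
by apply: mderiv_mulX_homog; exact: dhomog_is_dhomog.
Qed.

Definition Dop (M : 'M[K]_d.+1) (q : P) : P :=
  [ffun i => DHomog (Dcol_homog M q i)].

Definition dPn (r : K -> P) (x : K) : P :=
  \sum_i derive1 (fun t : K => coord (vbasis {:P}) i (r t)) x *: (vbasis {:P})`_i.

End HomogeneousVectorPolynomials.

Section Operators.
Variables (K : numFieldType) (d : nat) (A B : 'M[K]_d.+1).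

Definition Mfun (x : K) : 'M[K]_d.+1 :=
  (x - 1)^-1 *: A + (x + 1)^-1 *: B.

Definition Qfun (x : K) : K := x ^+ 2 - 1.

Definition fundamental_near (x : K) (Y : K -> 'M[K]_d.+1) : Prop :=
  \forall z \near x, Y z \in unitmx /\
    forall i j, is_derive z (1 : K) (fun t : K => Y t i j) ((Mfun z *m Y z) i j).

Definition derivn_col (k : nat) (F : K -> 'cV[K]_d.+1) (x : K) : 'cV[K]_d.+1 :=
  \col_i derive1n k (fun t : K => F t i 0) x.

(* The value at w of P_k(x) q computed from Y; that it is homogeneous polynomial
   in w and independent of Y is part of what has to be proved. *)
Definition Pk n (Y : K -> 'M[K]_d.+1) (k : nat) (x : K) (q : Pn K d n)
    (w : 'cV[K]_d.+1) : 'cV[K]_d.+1 :=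
  Y x *m derivn_col k
    (fun t => Qfun t ^+ k *: (invmx (Y t) *m ev q (Y t *m invmx (Y x) *m w))) x.

Definition calA n (j : nat) (r : K -> Pn K d n) : K -> Pn K d n := fun x =>
  x *: ((2 * j)%:R *: r x + Dop (A + B) (r x)) + Dop (A - B) (r x)
  + Qfun x *: dPn r x.

(* calA k is applied first and calA 1 last. *)
Definition calA_comp n (k : nat) : (K -> Pn K d n) -> K -> Pn K d n :=
  \big[comp/id]_(1 <= j < k.+1) calA j.

End Operators.

Definition nonresonant (K : numFieldType) (d : nat) (lam : 'I_d -> K) : Prop :=
  forall (m : 'I_d -> nat) (j : 'I_d) (p : nat),
    \sum_i (m i)%:R * lam i - lam j <> - p.+1%:R.

(* Main.v *)
From HB Require Import structures.
Require Import Defs.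
From mathcomp Require Import all_boot all_order all_algebra perm.
From mathcomp Require Import all_classical all_reals all_analysis.
From mathcomp Require Import -(notations) mpoly.
From mathcomp Require Import complex ring.
Set Implicit Arguments.
Unset Strict Implicit.
Unset Printing Implicit Defensive.
Import Order.TTheory GRing.Theory Num.Theory numFieldNormedType.Exports.
Local Open Scope ring_scope.

(** Conjugation by the flow of y' = M y turns d/dt into the operators calA j.
    Fix v and let r be a family of homogeneous polynomial maps depending
    polynomially on t. Differentiate Q^j Y^-1 r(Y v): the factor Q^j gives
    2 j t, because Q' = 2 t; the factor Y^-1 gives - M, because
    (Y^-1)' = - Y^-1 M; the inner Y gives the Jacobian of r applied to M Y v,
    and r itself gives its partial derivative in t. Since
    Q M = t (A + B) + (A - B), the outcome is exactly
      Q^(j-1) Y^-1 (calA j r)(Y v),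
    which is [mxderive_conjugate]. Starting from Q^k and a constant family and
    iterating k times removes every power of Q and applies calA k, ..., calA 1
    in this order ([derivn_conjugate]); at t = x and v = Y(x)^-1 w this is the
    formula for P_k. The identity is local, so it has to be carried along a
    whole neighbourhood of x, on which t <> 1 and t <> -1.

    Polynomiality in x is then algebra: calA j sends sum_i t^i e_i to a
    polynomial whose degree is at most one more, with coefficients given by [step_coef]
    ([calA_polfam]). The coefficients of P_k are thus explicit linear operators
    built from D_1 and D_2 ([calA_comp_polfam]), and those of degree above k
    vanish.

    The degree is exactly k because the top coefficient is the product over
    1 <= j <= k of k + j + D_1: each calA j multiplies the top coefficient of a
    polynomial of degree m by 2 j + m + D_1. To see that it is nonzero it is
    enough to test it on one eigenvector of D_1. If l is a left eigenvector and
    v a right eigenvector of A + B, both for the eigenvalue a, then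
    w |-> (l w)^n v is an eigenvector of D_1 with eigenvalue n a - a
    ([Dop_rank_one]), and nonresonance keeps all the factors k + j + n a - a
    away from zero ([comp_coef_top]). *)

(** * Derivatives of scalar and matrix functions *)

Section ScalarCalculus.
Variables (K : numFieldType) (z : K).
Implicit Types (f g : K -> K).

Lemma is_derive_mul f g (df dg : K) :
  is_derive z (1 : K) f df -> is_derive z (1 : K) g dg ->
  is_derive z (1 : K) (fun t => f t * g t) (df * g z + f z * dg).
Proof.
move=> hf hg; apply: (is_derive_eq (is_deriveM hf hg)).
by rewrite addrC mulrC.
Qed.

Lemma is_derive_bigsum (I : Type) (s : seq I) (f : I -> K -> K) (df : I -> K) :
  (forall i, is_derive z (1 : K) (f i) (df i)) ->
  is_derive z (1 : K) (fun t => \sum_(i <- s) f i t) (\sum_(i <- s) df i).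
Proof.
move=> hf; elim: s => [|i s IH].
  rewrite big_nil (_ : (fun=> _) = cst 0); first exact: is_derive_cst.
  by apply/funext => t; rewrite big_nil.
rewrite big_cons (_ : (fun=> _) = f i + (fun t => \sum_(i <- s) f i t)).
  exact: is_deriveD.
by apply/funext => t; rewrite big_cons.
Qed.

Lemma is_derive_exprn j : is_derive z (1 : K) (fun t => t ^+ j) (j%:R * z ^+ j.-1).
Proof.
elim: j => [|j IH].
  by rewrite mul0r (_ : (fun=> _) = cst 1) //; exact: is_derive_cst.
rewrite (_ : (fun=> _) = fun t => t * t ^+ j); last first.
  by apply/funext => t; rewrite exprS.
apply: (is_derive_eq (is_derive_mul (f := id) (is_derive_id z 1) IH)).
by case: j {IH} => [|j] /=; rewrite ?exprS; ring.
Qed.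

Lemma derivable_bigprod (I : Type) (s : seq I) (f : I -> K -> K) :
  (forall i, derivable (f i) z 1) -> derivable (fun t => \prod_(i <- s) f i t) z 1.
Proof.
move=> hf; elim: s => [|i s IH].
  rewrite (_ : (fun=> _) = cst 1); first exact: derivable_cst.
  by apply/funext => t; rewrite big_nil.
rewrite (_ : (fun=> _) = f i * (fun t => \prod_(i <- s) f i t)).
  exact: derivableM.
by apply/funext => t; rewrite big_cons.
Qed.

End ScalarCalculus.

Lemma derive1n_near_eq (K : numFieldType) (k : nat) (f g : K -> K) (z : K) :
  (\forall t \near z, f t = g t) -> derive1n k f z = derive1n k g z.
Proof.
elim: k f g z => [|k IH] f g z fg; first exact: nbhs_singleton fg.
rewrite !derive1Sn; apply: IH.
apply: filterS (near_join fg) => t fgt.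
by rewrite !derive1E; exact: near_eq_derive.
Qed.

Section EntrywiseDerivative.
Variables (K : numFieldType) (z : K).

(** Entrywise, because this is how the derivative of a fundamental matrix is
    given; over a complex field it also avoids choosing a matrix norm. *)
Definition mxderive m n (F : K -> 'M[K]_(m, n)) (dF : 'M[K]_(m, n)) :=
  forall i j, is_derive z (1 : K) (fun t => F t i j) (dF i j).

Lemma mxderive_cst m n (C : 'M[K]_(m, n)) : mxderive (fun=> C) 0.
Proof. by move=> i j; rewrite mxE; exact: is_derive_cst. Qed.

Lemma mxderiveZ m n (a : K -> K) (da : K) (F : K -> 'M[K]_(m, n)) dF :
  is_derive z (1 : K) a da -> mxderive F dF ->
  mxderive (fun t => a t *: F t) (da *: F z + a z *: dF).
Proof.
move=> ha hF i j; rewrite !mxE (_ : (fun=> _) = fun t => a t * F t i j).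
  exact: is_derive_mul.
by apply/funext => t; rewrite mxE.
Qed.

Lemma mxderiveM m n p (F : K -> 'M[K]_(m, n)) (G : K -> 'M[K]_(n, p)) dF dG :
  mxderive F dF -> mxderive G dG ->
  mxderive (fun t => F t *m G t) (dF *m G z + F z *m dG).
Proof.
move=> hF hG i j; rewrite !mxE -big_split /=.
rewrite (_ : (fun=> _) = fun t => \sum_l F t i l * G t l j); last first.
  by apply/funext => t; rewrite mxE.
by apply: is_derive_bigsum => l; exact: is_derive_mul.
Qed.

Lemma mxderive_sum m n (I : Type) (s : seq I) (F : I -> K -> 'M[K]_(m, n)) dF :
  (forall i, mxderive (F i) (dF i)) ->
  mxderive (fun t => \sum_(i <- s) F i t) (\sum_(i <- s) dF i).
Proof.
move=> hF a b; rewrite summxE.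
rewrite (_ : (fun=> _) = fun t => \sum_(i <- s) F i t a b); last first.
  by apply/funext => t; rewrite summxE.
by apply: is_derive_bigsum => i; exact: hF.
Qed.

Lemma mxderive_unique m n (F : K -> 'M[K]_(m, n)) dF dF' :
  mxderive F dF -> mxderive F dF' -> dF = dF'.
Proof.
move=> h h'; apply/matrixP => i j.
by rewrite -(@derive_val _ _ _ _ _ _ _ (h i j)) (@derive_val _ _ _ _ _ _ _ (h' i j)).
Qed.

Lemma mxderive_near_eq m n (F G : K -> 'M[K]_(m, n)) dF :
  (\forall t \near z, F t = G t) -> mxderive F dF -> mxderive G dF.
Proof.
move=> FG hF i j; apply: near_eq_is_derive (hF i j).
by apply: filterS FG => t ->.
Qed.

Lemma derivable_det n (F : K -> 'M[K]_n) :
  (forall i j, derivable (fun t => F t i j) z 1) ->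
  derivable (fun t => \det (F t)) z 1.
Proof.
move=> hF.
have hs (s : {perm 'I_n}) :
    derivable (fun t => (-1) ^+ s * \prod_i F t i (s i)) z 1.
  apply: (derivableM (f := cst _)); first exact: derivable_cst.
  exact: derivable_bigprod.
apply: (@ex_derive _ _ _ _ _ _ _
  (is_derive_bigsum (index_enum _) (fun s => derivableP (hs s)))).
Qed.

(** The inverse is a rational function of the entries, hence differentiable;
    differentiating Y^-1 Y = 1 then identifies its derivative. *)
Lemma mxderive_invmx n (Y : K -> 'M[K]_n) dY :
  (\forall t \near z, Y t \in unitmx) -> mxderive Y dY ->
  mxderive (fun t => invmx (Y t)) (- (invmx (Y z) *m dY *m invmx (Y z))).
Proof.
move=> uY hY; have uYz : Y z \in unitmx := nbhs_singleton uY.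
have dvY i j : derivable (fun t => Y t i j) z 1 := @ex_derive _ _ _ _ _ _ _ (hY i j).
pose G t := (\det (Y t))^-1 *: \adj (Y t).
have YG : \forall t \near z, G t = invmx (Y t).
  by apply: filterS uY => t ut; rewrite /invmx ut.
have dvG i j : derivable (fun t => G t i j) z 1.
  rewrite (_ : (fun=> _) = (fun t => (\det (Y t))^-1) * ((cst ((-1) ^+ (j + i)))
      * (fun t => \det (row' j (col' i (Y t)))))); last first.
    by apply/funext => t; rewrite !mxE.
  apply: derivableM.
    apply: derivableV; last exact: derivable_det.
    by move: uYz; rewrite unitmxE unitfE.
  apply: derivableM; first exact: derivable_cst.
  apply: derivable_det => a b.
  by rewrite (_ : (fun=> _) = fun t => Y t (lift j a) (lift i b)) //;
     apply/funext => t; rewrite !mxE.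
pose dG := \matrix_(i, j) 'D_1 (fun t => G t i j) z.
have hG : mxderive (fun t => invmx (Y t)) dG.
  apply: mxderive_near_eq YG _ => i j; rewrite mxE; exact: derivableP.
suff <- : dG = - (invmx (Y z) *m dY *m invmx (Y z)) by [].
(* Two derivatives of the constant function Y^-1 Y. *)
have h1 : mxderive (fun=> 1%:M) (dG *m Y z + invmx (Y z) *m dY).
  apply: mxderive_near_eq (mxderiveM hG hY).
  by apply: filterS uY => t ut; rewrite mulVmx.
have /eqP := mxderive_unique h1 (mxderive_cst 1%:M).
rewrite addr_eq0 => /eqP h2.
by rewrite -[LHS](mulmxK uYz) h2 mulNmx.
Qed.

End EntrywiseDerivative.

(** * Homogeneous polynomial maps along a curve *)

Section Evaluation.
Variables (K : numFieldType) (d n : nat).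
Local Notation P := (Pn K d n).
Implicit Types (p q : P) (M : 'M[K]_d.+1) (w : 'cV[K]_d.+1).

Lemma ev_linear_comb a p q w : ev (a *: p + q) w = a *: ev p w + ev q w.
Proof.
apply/colP => i; rewrite !mxE !ffunE.
by rewrite linearP.
Qed.

Lemma ev0 w : ev (0 : P) w = 0.
Proof. by apply/colP => i; rewrite !mxE ffunE raddf0. Qed.

Lemma evZ a q w : ev (a *: q) w = a *: ev q w.
Proof. by rewrite -[a *: q]addr0 ev_linear_comb ev0 addr0. Qed.

Lemma evD p q w : ev (p + q) w = ev p w + ev q w.
Proof. by rewrite -[p]scale1r ev_linear_comb !scale1r. Qed.

Lemma ev_sum (I : Type) (s : seq I) (F : I -> P) w :
  ev (\sum_(i <- s) F i) w = \sum_(i <- s) ev (F i) w.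
Proof. by elim: s => [|i s IH]; rewrite !(big_nil, big_cons) ?ev0 // evD IH. Qed.

Definition evJac q w : 'M[K]_d.+1 := map_mx (meval (fun l => w l 0)) (Jac q).

Lemma evJac_comb (I : Type) (s : seq I) (a : I -> K) (F : I -> P) w :
  evJac (\sum_(i <- s) a i *: F i) w = \sum_(i <- s) a i *: evJac (F i) w.
Proof.
elim: s => [|i s IH]; apply/matrixP => k l; rewrite !(big_nil, big_cons).
  by rewrite !mxE ffunE !raddf0.
by rewrite -IH !mxE !ffunE linearP /= linearP.
Qed.

(** On values, [Dop] is the bracket of [q] with the linear vector field of [M];
    this is the form in which it appears when conjugating by a linear flow. *)
Lemma ev_Dop M q w : ev (Dop M q) w = evJac q w *m (M *m w) - M *m ev q w.
Proof.
apply/colP => i; rewrite !mxE ffunE /= !mxE mevalB.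
congr (_ - _); rewrite raddf_sum /=; apply: eq_bigr => j _; rewrite !mxE mevalM.
  congr (_ * _); rewrite raddf_sum /=; apply: eq_bigr => l _.
  by rewrite !mxE mevalM mevalC mevalXU.
by rewrite mevalC.
Qed.

Lemma Dop_is_linear M : linear (Dop M : P -> P).
Proof.
move=> a p q; apply/ffunP => i; rewrite !ffunE; apply: val_inj => /=.
rewrite !mxE scalerBr addrACA -opprD.
congr (_ - _); rewrite scaler_sumr -big_split /=; apply: eq_bigr => j _.
  by rewrite !mxE !ffunE linearP /= mulrDl scalerAl.
by rewrite !mxE !ffunE linearP /= mulrDr scalerAr.
Qed.

HB.instance Definition _ M :=
  GRing.isLinear.Build K P P _ (Dop M) (Dop_is_linear M).

End Evaluation.

Section ChainRule.
Variables (K : numFieldType) (d n : nat) (z : K).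

(** The chain rule for polynomials: the polynomials satisfying it form a ring
    that contains the constants and the variables. *)
Lemma is_derive_meval (u : K -> 'cV[K]_d.+1) du (p : mpoly d.+1 K) :
  mxderive z u du ->
  is_derive z (1 : K) (fun t => meval (fun l => u t l 0) p)
    (\sum_l meval (fun l => u z l 0) (mderiv l p) * du l 0).
Proof.
move=> hu.
pose good p := is_derive z (1 : K) (fun t => meval (fun l => u t l 0) p)
    (\sum_l meval (fun l => u z l 0) (mderiv l p) * du l 0).
have goodC c : good (mpolyC d.+1 c).
  rewrite /good big1 => [|l _]; last by rewrite mderivC meval0 mul0r.
  rewrite (_ : (fun=> _) = cst c); first exact: is_derive_cst.
  by apply/funext => t; rewrite mevalC.
have goodD p1 p2 : good p1 -> good p2 -> good (p1 + p2).
  move=> h1 h2; rewrite /good (_ : (fun=> _) = (fun t => meval (fun l => u t l 0) p1)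
      + (fun t => meval (fun l => u t l 0) p2)); last first.
    by apply/funext => t; rewrite mevalD.
  apply: (is_derive_eq (is_deriveD h1 h2)); rewrite -big_split /=.
  by apply: eq_bigr => l _; rewrite mderivD mevalD mulrDl.
have goodM p1 p2 : good p1 -> good p2 -> good (p1 * p2).
  move=> h1 h2; rewrite /good (_ : (fun=> _) = (fun t => meval (fun l => u t l 0) p1
      * meval (fun l => u t l 0) p2)); last first.
    by apply/funext => t; rewrite mevalM.
  apply: (is_derive_eq (is_derive_mul h1 h2)).
  rewrite mulr_suml mulr_sumr -big_split /=.
  by apply: eq_bigr => l _; rewrite mderivM mevalD !mevalM; ring.
have goodX i : good (mpolyX K (mnm1 i)).
  rewrite /good (_ : (fun=> _) = fun t => u t i 0); last first.
    by apply/funext => t; rewrite mevalXU.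
  apply: (is_derive_eq (hu i 0)); rewrite (bigD1 i) //= big1 => [|l li].
    have -> : mderiv i (mpolyX K (mnm1 i)) = 1.
      rewrite mderivX mnm1E eqxx scale1r -mpolyX0; congr mpolyX.
      by apply/mnmP => l; rewrite mnmBE mnm0E subnn.
    by rewrite meval1 mul1r addr0.
  by rewrite mderivX mnm1E eq_sym (negPf li) scale0r meval0 mul0r.
apply: (@mpolyind _ _ good) => [|c m q _ _ hq]; first by rewrite -mpolyC0.
apply: goodD hq; rewrite -mul_mpolyC; apply: (goodM) => //.
rewrite mpolyXE_id; apply: (big_ind good) => [|a b|i _].
- by rewrite -mpolyC1.
- exact: goodM.
- by elim: (m i) => [|e IH]; rewrite ?expr0 -?mpolyC1 // exprS; exact: goodM.
Qed.

Lemma mxderive_ev (q : Pn K d n) (u : K -> 'cV[K]_d.+1) du :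
  mxderive z u du -> mxderive z (fun t => ev q (u t)) (evJac q (u z) *m du).
Proof.
move=> hu i j; rewrite !mxE (_ : (fun=> _) = fun t => meval (fun l => u t l 0) (q i)).
  apply: (is_derive_eq (is_derive_meval _ hu)).
  by rewrite ord1; apply: eq_bigr => l _; rewrite !mxE.
by apply/funext => t; rewrite mxE.
Qed.

End ChainRule.

Section PolynomialFamilies.
Variables (K : numFieldType) (d n : nat).
Local Notation P := (Pn K d n).

(** The families polynomial in t are the class in which the iteration takes
    place: it contains the constant families and is stable under every
    [calA j]. *)
Definition polfam N (e : nat -> P) : K -> P := fun t => \sum_(i < N) t ^+ i *: e i.

(** [dPn] is defined by coordinates in a chosen basis; on polynomial families
    it does not depend on that choice. *)
Lemma dPn_polfam N e x :
  dPn (polfam N e) x = \sum_(i < N) (i%:R * x ^+ i.-1) *: e i.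
Proof.
rewrite /dPn [RHS](coord_vbasis (memvf _)); apply: eq_bigr => i _; congr (_ *: _).
rewrite (_ : (fun=> _) = fun t => \sum_(j < N) t ^+ j * coord (vbasis {:P}) i (e j)).
  rewrite derive1E linear_sum /=; apply: derive_val.
  apply: is_derive_bigsum => j; rewrite linearZ /=.
  apply: (is_derive_eq (is_derive_mul (is_derive_exprn x j) (is_derive_cst _ x 1))).
  by rewrite mulr0 addr0.
by apply/funext => t; rewrite linear_sum; apply: eq_bigr => j _; rewrite linearZ.
Qed.

Lemma mxderive_ev_polfam N (e : nat -> P) z (u : K -> 'cV[K]_d.+1) du :
  mxderive z u du ->
  mxderive z (fun t => ev (polfam N e t) (u t))
    (ev (dPn (polfam N e) z) (u z) + evJac (polfam N e z) (u z) *m du).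
Proof.
move=> hu; rewrite dPn_polfam.
have := mxderive_sum (index_enum _) (fun i : 'I_N =>
  mxderiveZ (is_derive_exprn z i) (mxderive_ev (e i) hu)).
rewrite big_split /= (_ : (fun t => _) = fun t => ev (polfam N e t) (u t)); last first.
  by apply/funext => t; rewrite ev_sum; apply: eq_bigr => i _; rewrite evZ.
set S1 := (X in X + _); set S2 := (X in _ + X).
suff [-> ->] : S1 = ev (\sum_(i < N) (i%:R * z ^+ i.-1) *: e i) (u z)
  /\ S2 = evJac (polfam N e z) (u z) *m du by [].
split; first by rewrite ev_sum; apply: eq_bigr => i _; rewrite evZ.
under [LHS]eq_bigr do rewrite scalemxAl.
by rewrite -mulmx_suml evJac_comb.
Qed.

End PolynomialFamilies.

(** * Conjugation by a fundamental matrix *)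

Section DerivativeFormula.
Variables (K : numFieldType) (d n : nat) (A B : 'M[K]_d.+1).
Local Notation P := (Pn K d n).

(** The action of [calA j] on the sequence of coefficients of a polynomial
    family: x (2 j + D_1) and x^2 d/dx raise the degree by one, D_2 preserves it
    and - d/dx lowers it by one. The coefficients are kept as operators, not as
    values at a given polynomial map, since the coefficients of P_k have to be
    linear operators. *)
Definition step_coef (j : nat) (e : nat -> 'End(P)) (i : nat) : 'End(P) :=
  (if i is i'.+1 then
     (2 * j + i')%:R *: e i' + (linfun (Dop (A + B)) \o e i')%VF
   else 0)
  + (linfun (Dop (A - B)) \o e i)%VF - i.+1%:R *: e i.+1.

Lemma calA_polfam j N (e : nat -> 'End(P)) (q : P) :
  (forall i, (N <= i)%N -> e i = 0) ->
  calA A B j (polfam N (fun i => e i q)) =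
  polfam N.+1 (fun i => step_coef j e i q).
Proof.
move=> e0; apply/funext => x.
have eq0 i : (N <= i)%N -> e i q = 0 by move/e0 ->; rewrite zero_lfunE.
(* Reindexing the derivative in t; the boundary term vanishes as e N = 0. *)
have shift : \sum_(i < N) (i%:R * x ^+ i.-1) *: e i q
    = \sum_(i < N) x ^+ i *: (i.+1%:R *: e i.+1 q).
  case: N eq0 {e0} => [|N'] eq0; first by rewrite !big_ord0.
  rewrite big_ord_recl big_ord_recr /= mul0r scale0r add0r eq0 // !scaler0 addr0.
  by apply: eq_bigr => i _; rewrite scalerA mulrC.
rewrite [RHS]/polfam [RHS](eq_bigr (fun i : 'I_N.+1 =>
    x ^+ i *: (if (i : nat) is i'.+1 then
       (2 * j + i')%:R *: e i' q + Dop (A + B) (e i' q) else 0)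
    + x ^+ i *: (Dop (A - B) (e i q) - i.+1%:R *: e i.+1 q))); last first.
  move=> [[|i] hi] _ /=; rewrite /step_coef -scalerDr addrA;
  by rewrite !(add_lfunE, opp_lfunE, scale_lfunE, zero_lfunE, comp_lfunE, lfunE).
rewrite big_split /= big_ord_recl /= scaler0 add0r.
rewrite big_ord_recr /= eq0 // linear0 eq0 // scaler0 subr0 scaler0 addr0.
rewrite /calA (_ : Qfun x *: _ = \sum_(i < N) (i%:R * x ^+ i.+1) *: e i q
    - \sum_(i < N) x ^+ i *: (i.+1%:R *: e i.+1 q)); last first.
  rewrite -shift dPn_polfam /Qfun scalerBl scale1r scaler_sumr.
  congr (_ - _); apply: eq_bigr => -[[|i] hi] _ /=; rewrite scalerA ?mul0r ?mulr0 //.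
  by congr (_ *: _); rewrite !exprS; ring.
rewrite /polfam !(linear_sum (Dop _)) !scaler_sumr -big_split scaler_sumr /=.
rewrite addrACA -sumrB -[X in X + _ = _]big_split /=; congr (_ + _); apply: eq_bigr => i _.
  rewrite add0n [Dop _ (_ *: _)]linearZ /= !scalerDr !scalerA addrAC -scalerDl exprS.
  by congr (_ *: _ + _); rewrite natrD; ring.
by rewrite [Dop _ (_ *: _)]linearZ /= scalerBr.
Qed.


Lemma Qfun_Mfun (z : K) : z != 1 -> z != -1 ->
  Qfun z *: Mfun A B z = z *: (A + B) + (A - B).
Proof.
move=> z1 zN1; have h1 : z - 1 != 0 by rewrite subr_eq0.
have h2 : z + 1 != 0 by rewrite addr_eq0.
rewrite /Qfun /Mfun (_ : z ^+ 2 - 1 = (z - 1) * (z + 1)); last by ring.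
rewrite scalerDr !scalerA mulrAC divff // mul1r -mulrA divff // mulr1.
by rewrite scalerDl scalerBl scalerDr !scale1r addrACA.
Qed.

Lemma is_derive_Qfun_exp (z : K) j :
  is_derive z (1 : K) (fun t => Qfun t ^+ j.+1) (Qfun z ^+ j * (z * (2 * j.+1)%:R)).
Proof.
have hQ : is_derive z (1 : K) (@Qfun K) (z * 2%:R).
  rewrite (_ : @Qfun K = (fun t => t ^+ 2) - cst 1) //.
  have H := is_deriveB (is_derive_exprn z 2) (is_derive_cst (1 : K) z (1 : K)).
  apply: (is_derive_eq H).
  by rewrite subr0 mulrC.
elim: j => [|j IH].
  rewrite (_ : (fun=> _) = @Qfun K); last by apply/funext => t; rewrite expr1.
  by rewrite expr0 mul1r muln1.
rewrite (_ : (fun=> _) = fun t => Qfun t * Qfun t ^+ j.+1); last first.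
  by apply/funext => t; rewrite exprS.
apply: (is_derive_eq (is_derive_mul hQ IH)).
by rewrite !exprS !natrM -[j.+2]addn1 natrD; ring.
Qed.

(** Conjugation by Y and by the weight Q^j intertwines [calA j] with d/dt, at
    the cost of one power of Q. That power is what clears the poles of M at 1
    and -1. *)
Lemma mxderive_conjugate (Y : K -> 'M[K]_d.+1) (z : K) j N (e : nat -> P) v :
  z != 1 -> z != -1 -> (\forall t \near z, Y t \in unitmx) ->
  mxderive z Y (Mfun A B z *m Y z) ->
  mxderive z
    (fun t => Qfun t ^+ j.+1 *: (invmx (Y t) *m ev (polfam N e t) (Y t *m v)))
    (Qfun z ^+ j *:
       (invmx (Y z) *m ev (calA A B j.+1 (polfam N e) z) (Y z *m v))).
Proof.
move=> z1 zN1 uY hY; have uYz := nbhs_singleton uY.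
have hu := mxderiveM hY (mxderive_cst z v).
have := mxderiveZ (is_derive_Qfun_exp z j)
  (mxderiveM (mxderive_invmx uY hY) (mxderive_ev_polfam N e hu)).
set D := (X in mxderive _ _ X); suff -> : D = Qfun z ^+ j *:
  (invmx (Y z) *m ev (calA A B j.+1 (polfam N e) z) (Y z *m v)) by [].
rewrite {}/D /calA !(evD, evZ) !ev_Dop mulmx0 addr0 exprSr -!scalerA -scalerDr.
congr (_ *: _); rewrite -!mulmxA mulmxV // mulmx1 mulNmx -mulmxA -mulmxN -mulmxDr.
rewrite !scalemxAr -mulmxDr; congr (_ *m _).
set E := ev (polfam N e z) _; set J := evJac _ _; set u := Y z *m v.
(* The two terms containing M absorb the factor Q. *)
have hE : Qfun z *: (Mfun A B z *m E) = z *: ((A + B) *m E) + (A - B) *m E.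
  by rewrite scalemxAl Qfun_Mfun // mulmxDl scalemxAl.
have hJ : Qfun z *: (J *m (Mfun A B z *m u))
    = z *: (J *m ((A + B) *m u)) + J *m ((A - B) *m u).
  by rewrite scalemxAr (scalemxAl (Qfun z)) Qfun_Mfun // mulmxDl mulmxDr -scalemxAl -scalemxAr.
rewrite !scalerDr scalerN hE hJ.
move: (_ *m E) ((A - B) *m E) (J *m _) (J *m ((A - B) *m u)) (ev _ _) => a b c f g.
by apply/colP => i; rewrite !mxE; ring.
Qed.

End DerivativeFormula.

(** * Iterating the operators *)

Lemma near_neq (K : numFieldType) (x a : K) : x != a -> \forall t \near x, t != a.
Proof.
move=> xa; apply/nbhs_ballP; exists `|x - a|; first by rewrite /= normr_gt0 subr_eq0.
by move=> t xt; apply: contraTneq xt => ->; rewrite /ball /= ltxx.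
Qed.

Section Iteration.
Variables (K : numFieldType) (d n : nat) (A B : 'M[K]_d.+1).
Local Notation P := (Pn K d n).

(** The operator that acts first is the one of highest index, so it is the
    argument of the composition, not its head, that changes with [k]. *)
Lemma calA_compS k (r : K -> P) :
  calA_comp A B k.+1 r = calA_comp A B k (calA A B k.+1 r).
Proof.
rewrite /calA_comp; have -> : index_iota 1 k.+2 = rcons (index_iota 1 k.+1) k.+1.
  by rewrite /index_iota !subSS !subn0 -(addn1 k) iotaD cats1 add1n addn1.
elim: (index_iota 1 k.+1) => [|j s IH] /=; first by rewrite big_cons !big_nil.
by rewrite !big_cons /= IH.
Qed.

Fixpoint comp_coef k (e : nat -> 'End(P)) : nat -> 'End(P) :=
  if k is k'.+1 then comp_coef k' (step_coef A B k e) else e.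

Lemma step_coef_eq0 j N (e : nat -> 'End(P)) :
  (forall i, (N <= i)%N -> e i = 0) ->
  forall i, (N.+1 <= i)%N -> step_coef A B j e i = 0.
Proof.
move=> e0 [|i] // Ni; rewrite /step_coef !e0 ?(ltnW Ni) //; last exact: ltnW (ltnW _).
by rewrite !comp_lfun0r !scaler0 !addr0 subr0.
Qed.

Lemma calA_comp_polfam k N (e : nat -> 'End(P)) (q : P) :
  (forall i, (N <= i)%N -> e i = 0) ->
  calA_comp A B k (polfam N (fun i => e i q)) =
  polfam (N + k) (fun i => comp_coef k e i q).
Proof.
elim: k N e => [|k IH] N e e0.
  by rewrite addn0 /calA_comp big_nil.
by rewrite calA_compS calA_polfam // IH ?addSnnS //; exact: step_coef_eq0.
Qed.

(** On an eigenvector of D_1 for [mu], the step of index j scales the top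
    coefficient of a polynomial of degree m by 2 j + m + mu, where 2 j + m is a
    positive integer. *)
Lemma comp_coef_top k m (e : nat -> 'End(P)) (q : P) (mu a : K) :
  Dop (A + B) q = mu *: q -> (forall p : nat, mu <> - p.+1%:R) ->
  (forall i, (m < i)%N -> e i = 0) -> e m q = a *: q -> a != 0 ->
  exists2 b, comp_coef k e (m + k) q = b *: q & b != 0.
Proof.
move=> Dq mu_neg; elim: k m e a => [|k IH] m e a e0 em a0.
  by exists a; rewrite ?addn0.
rewrite -addSnnS /=; apply: (IH _ _ (((2 * k.+1 + m)%:R + mu) * a)).
- exact: step_coef_eq0.
- rewrite /step_coef (e0 m.+1) // (e0 m.+2) // comp_lfun0r scaler0 subr0 addr0.
  rewrite add_lfunE scale_lfunE comp_lfunE lfunE /= em [Dop _ _]linearZ /= Dq.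
  by rewrite !scalerA -scalerDl mulrDl [mu * a]mulrC.
- rewrite mulf_neq0 // addr_eq0 eq_sym; apply/eqP => h.
  apply: (mu_neg (2 * k.+1 + m).-1); rewrite prednK; last by rewrite mulnS.
  by rewrite -h opprK.
Qed.

(** Peeling off the innermost derivative replaces the family by its image under
    [calA k] and k by k - 1. The induction therefore runs over all polynomial
    families, although the application starts from a constant one. *)
Lemma derivn_conjugate k N (e : nat -> 'End(P)) (q : P) (Y : K -> 'M[K]_d.+1) x v :
  x != 1 -> x != -1 -> fundamental_near A B x Y ->
  (forall i, (N <= i)%N -> e i = 0) ->
  derivn_col k (fun t => Qfun t ^+ k *:
     (invmx (Y t) *m ev (polfam N (fun i => e i q) t) (Y t *m v))) x =
  invmx (Y x) *m ev (calA_comp A B k (polfam N (fun i => e i q)) x) (Y x *m v).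
Proof.
move=> x1 xN1 fY.
have n1 := near_neq x1; have nN1 := near_neq xN1.
elim: k N e => [|k IH] N e e0.
  rewrite /calA_comp big_nil; apply/colP => i; rewrite mxE derive1n0.
  by rewrite expr0 scale1r.
rewrite calA_compS calA_polfam // -IH; last exact: step_coef_eq0.
apply/colP => i; rewrite !mxE derive1Sn; apply: derive1n_near_eq.
have := near_join fY; move: n1 nN1; apply: filterS3 => z z1 zN1 fz.
have uY : \forall t \near z, Y t \in unitmx by apply: filterS fz => t [].
have hY : mxderive z Y (Mfun A B z *m Y z) by have [] := nbhs_singleton fz.
rewrite -calA_polfam // derive1E; apply: derive_val.
exact: (mxderive_conjugate k N (fun i => e i q) v z1 zN1 uY hY i 0).
Qed.

End Iteration.

(** * An eigenvector of D_1 *)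

Section RankOneEigenvector.
Variables (K : numFieldType) (d n : nat) (M : 'M[K]_d.+1).
Local Notation P := (Pn K d n).

Definition linform (l : 'rV[K]_d.+1) : mpoly d.+1 K :=
  \sum_i l 0 i *: mpolyX K (mnm1 i).

Lemma linform_homog (l : 'rV[K]_d.+1) : linform l \is ishomog1 1 mdeg.
Proof.
apply: rpred_sum => i _; apply: rpredZ; rewrite dhomogX; apply/eqP; exact: mdeg1.
Qed.

Lemma linform_neq0 (l : 'rV[K]_d.+1) : l != 0 -> linform l != 0.
Proof.
apply: contraNneq => l0; apply/eqP/rowP => i; rewrite mxE.
have := congr1 (mcoeff (mnm1 i)) l0; rewrite mcoeff0 raddf_sum /= => <-.
rewrite (bigD1 i) //= big1 => [|j ji].
  by rewrite mcoeffZ mcoeffXU eqxx mulr1 addr0.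
by rewrite mcoeffZ mcoeffXU (negPf ji) mulr0.
Qed.

Lemma mderiv_linform_exp (l : 'rV[K]_d.+1) j :
  mderiv j (linform l ^+ n) = l 0 j *: (linform l ^+ n.-1 *+ n).
Proof.
have dL : mderiv j (linform l) = mpolyC d.+1 (l 0 j).
  rewrite raddf_sum /= (bigD1 j) //= big1 => [|i ij].
    rewrite mderivZ mderivX mnm1E eqxx scale1r addr0 -mul_mpolyC.
    rewrite (_ : mnm_sub _ _ = mnm0) ?mpolyX0 ?mulr1 //.
    by apply/mnmP => i; rewrite mnmBE mnm0E subnn.
  by rewrite mderivZ mderivX mnm1E (negPf ij) scale0r scaler0.
elim: n => [|m IH]; first by rewrite expr0 -mpolyC1 mderivC mulr0n scaler0.
rewrite exprS mderivM IH dL -!mul_mpolyC -[_ *+ m]mulr_natr -[_ *+ m.+1]mulr_natr.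
rewrite [linform l * _]mulrCA -mulrDr; congr (_ * _).
case: m {IH} => [|m] /=; first by rewrite !mulr0 addr0 mulr1.
by rewrite mulrA -exprS -[m.+2]addn1 natrD mulrDr mulr1 addrC.
Qed.

Lemma rank_one_homog (l : 'rV[K]_d.+1) (v : 'cV[K]_d.+1) i :
  v i 0 *: linform l ^+ n \is ishomog1 n mdeg.
Proof.
by apply: rpredZ; have := dhomogMn n (linform_homog l); rewrite mul1n.
Qed.

(** The polynomial map w |-> (l w)^n v. *)
Definition rank_one (l : 'rV[K]_d.+1) (v : 'cV[K]_d.+1) : P :=
  [ffun i => DHomog (rank_one_homog l v i)].

Lemma rank_one_neq0 l v : l != 0 -> v != 0 -> rank_one l v != 0.
Proof.
move=> l0; apply: contraNneq => q0; apply/eqP/colP => i; rewrite mxE.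
have := congr1 (fun q : P => mpoly_of_dhomog (q i)) q0.
rewrite !ffunE raddf0 /= => /eqP; rewrite -mul_mpolyC mulf_eq0.
by rewrite expf_eq0 (negPf (linform_neq0 l0)) andbF orbF mpolyC_eq0 => /eqP.
Qed.

(** By the chain rule the differential of (l w)^n v in the direction M w is
    n (l w)^(n-1) (l M w) v, and l M w = a (l w). *)
Lemma Dop_rank_one l v (a b : K) :
  l *m M = a *: l -> M *m v = b *: v ->
  Dop M (rank_one l v) = (n%:R * a - b) *: rank_one l v.
Proof.
move=> lM Mv; apply/ffunP => i; rewrite !ffunE; apply: val_inj => /=.
rewrite scalerBl linearZ /= !mxE.
have lX : \sum_j l 0 j *: (constmx M *m vars K d) j 0 = a *: linform l.
  transitivity (\sum_k (l *m M) 0 k *: mpolyX K (mnm1 k)).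
    rewrite (eq_bigr (fun j => \sum_k (l 0 j * M j k) *: mpolyX K (mnm1 k))).
      by rewrite exchange_big; apply: eq_bigr => k _; rewrite mxE scaler_suml.
    move=> j _; rewrite mxE scaler_sumr; apply: eq_bigr => k _.
    by rewrite !mxE mul_mpolyC scalerA.
  by rewrite lM scaler_sumr; apply: eq_bigr => k _; rewrite mxE scalerA.
congr (_ - _).
  rewrite (eq_bigr (fun j => v i 0 *: (linform l ^+ n.-1 *+ n)
      * (l 0 j *: (constmx M *m vars K d) j 0))); last first.
    move=> j _; rewrite [Jac _ _ _]mxE ffunE /= mderivZ mderiv_linform_exp.
    by rewrite -!scalerAl -scalerAr.
  rewrite -mulr_sumr lX -scalerAl -scalerAr.
  case: n => [|m]; first by rewrite mulr0n !mul0r scale0r !scaler0.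
  by rewrite /= [_ * linform _]mulrnAl -exprSr mulrC -scalerA scaler_nat.
rewrite (eq_bigr (fun j => (M i j * v j 0) *: linform l ^+ n)).
  rewrite -scaler_suml scalerA; congr (_ *: _).
  by have := congr1 (fun w : 'cV_d.+1 => w i 0) Mv; rewrite !mxE.
by move=> j _; rewrite !mxE ffunE /= mul_mpolyC scalerA.
Qed.

End RankOneEigenvector.

(** * The operators P_k *)

Lemma char_poly_trmx (K : comNzRingType) m (M : 'M[K]_m) : char_poly M^T = char_poly M.
Proof.
rewrite /char_poly -det_tr; congr (\det _); rewrite /char_poly_mx.
by rewrite linearB /= tr_scalar_mx map_trmx trmxK.
Qed.

Definition const_coef (K : numFieldType) (d n : nat) (i : nat) : 'End(Pn K d n) :=
  if i is 0 then \1%VF else 0.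

Lemma const_coef_eq0 (K : numFieldType) (d n i : nat) :
  (0 < i)%N -> @const_coef K d n i = 0.
Proof. by case: i. Qed.

Lemma polfam_const (K : numFieldType) (d n : nat) (q : Pn K d n) :
  polfam 1 (fun i => const_coef K d n i q) = fun=> q.
Proof.
by apply/funext => t; rewrite /polfam big_ord1 /= expr0 scale1r id_lfunE.
Qed.

(** The same eigenvalue serves on the left and on the right, so that only one
    instance of nonresonance, with m = n times a basis vector, is involved. *)
Lemma exists_Dop_eigenvector (K : numFieldType) (d n : nat) (M : 'M[K]_d.+1) (a : K) :
  root (char_poly M) a ->
  exists2 q : Pn K d n, q != 0 & Dop M q = (n%:R * a - a) *: q.
Proof.
move=> ra.
have /eigenvalueP [l lM l0] : eigenvalue M a by rewrite eigenvalue_root_char.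
have /eigenvalueP [v vM v0] : eigenvalue M^T a.
  by rewrite eigenvalue_root_char char_poly_trmx.
exists (rank_one n l v^T).
  by apply: rank_one_neq0; rewrite // -trmx0 (inj_eq trmx_inj).
apply: Dop_rank_one => //.
by apply: trmx_inj; rewrite trmx_mul linearZ /= trmxK vM.
Qed.

Theorem proposition1 (R : realType) (d : nat) (A B : 'M[R[i]]_d.+1)
    (lam : 'I_d.+1 -> R[i])
    (AB_diag : diagonalizable (A + B))
    (lam_eigen : char_poly (A + B) = \prod_(i < d.+1) ('X - (lam i)%:P))
    (lam_nonres : nonresonant lam)
    (n k : nat) :
  exists c : nat -> 'End(Pn R[i] d n),
    c k != 0 /\
    forall (x : R[i]) (Y : R[i] -> 'M[R[i]]_d.+1),
      x != 1 -> x != -1 -> fundamental_near A B x Y ->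
      forall (q : Pn R[i] d n) (w : 'cV[R[i]]_d.+1),
        Pk Y k x q w = ev ((\sum_(i < k.+1) x ^+ i *: c i) q) w /\
        Pk Y k x q w = ev (calA_comp A B k (fun=> q) x) w.
Proof.
pose c := comp_coef A B k (const_coef R[i] d n).
have calA_c q : calA_comp A B k (fun=> q) = polfam k.+1 (fun i => c i q).
  by rewrite -polfam_const calA_comp_polfam //; exact: const_coef_eq0.
exists c; split.
  have root0 : root (char_poly (A + B)) (lam ord0).
    by rewrite lam_eigen (bigD1 ord0) //= rootM root_XsubC eqxx.
  have [q q0 Dq] := exists_Dop_eigenvector n root0.
  (* Nonresonance with m = n at the index 0 and 0 elsewhere. *)
  have nonres p : n%:R * lam ord0 - lam ord0 <> - p.+1%:R.
    have := lam_nonres (fun i => if i == ord0 then n else 0%N) ord0 p.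
    by rewrite (bigD1 ord0) //= big1 ?addr0 // => i /negPf ->; rewrite mul0r.
  have e0q : const_coef R[i] d n 0 q = 1 *: q by rewrite id_lfunE scale1r.
  have [b cq b0] := comp_coef_top (m := 0) k Dq nonres
    (fun i => @const_coef_eq0 _ _ _ i) e0q (oner_neq0 _).
  apply: contraNneq q0 => ck0; move: cq; rewrite add0n -/c ck0 zero_lfunE.
  by move/esym/eqP; rewrite scaler_eq0 (negPf b0).
move=> x Y x1 xN1 fY q w.
have uY : Y x \in unitmx by have [] := nbhs_singleton fY.
suff PkE : Pk Y k x q w = ev (calA_comp A B k (fun=> q) x) w.
  split => //; rewrite PkE calA_c /polfam sum_lfunE; congr ev.
  by apply: eq_bigr => i _; rewrite scale_lfunE.
have := derivn_conjugate k q (invmx (Y x) *m w) x1 xN1 fY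
  (fun i => @const_coef_eq0 R[i] d n i).
rewrite polfam_const /Pk => derivE.
under [X in derivn_col _ X]funext do rewrite -mulmxA.
by rewrite derivE !mulmxA mulmxV // !mul1mx.
Qed.
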